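(* Let $L$ be a compactly generated multiplicative lattice in which the top element $1$ is compact and every finite product of compact elements is compact. An element $s$ of $L$ is $z$-strongly irreducible (respectively, $z$-irreducible) if and only if $s$ is a strongly irreducible (respectively, irreducible) element as well as a $z$-element of $L$.
   Context: A multiplicative lattice is a complete lattice $(L,\leqslant,0,1)$ endowed with an associative, commutative multiplication which distributes over arbitrary joins and has $1$ as multiplicative identity. An element $c\in L$ is compact if for any $\{x_\lambda\}_{\lambda\in\Lambda}\subseteq L$, $c\leqslant\bigvee_{\lambda\in\Lambda}x_\lambda$ implies $c\leqslant\bigvee_{i=1}^n x_{\lambda_i}$ for some $n\in\mathbb{N}^+$ and $\lambda_1,\dots,\lambda_n\in\Lambda$; $L$ is compactly generated if every element of $L$ is a join of compact elements. An element $m\neq 1$ is maximal if $m\leqslant x$ and $x<1$ imply $m=x$, for all $x\in L$; $\mathcal{M}(L)$ is the set of maximal elements. For $a\in L$ put $\mathcal{M}_a=\{m\in\mathcal{M}(L)\mid a\leqslant m\}$. An element $x\in L$ is a $z$-element if for all $a,b\in L$, $\mathcal{M}_a=\mathcal{M}_b$ and $b\leqslant x$ imply $a\leqslant x$. An element $s\in L$ is strongly irreducible (resp. irreducible) if for all $a,b\in L$, $a\wedge b\leqslant s$ (resp. $a\wedge b=s$) implies $a\leqslant s$ (resp. $a=s$) or $b\leqslant s$ (resp. $b=s$). An element $s$ is $z$-strongly irreducible (resp. $z$-irreducible) if $s$ is a $z$-element and the same implication holds for all $z$-elements $a,b$ of $L$. *)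

(* Defs.v *)
From HB Require Import structures.
From mathcomp Require Import all_boot all_order.
From mathcomp Require Import boolp classical_sets.

Set Implicit Arguments.
Unset Strict Implicit.
Unset Printing Implicit Defensive.

Import Order.TTheory.
Local Open Scope classical_set_scope.
Local Open Scope order_scope.

HB.mixin Record isCompleteLattice d T of Order.TBLattice d T := {
  bigsup : set T -> T;
  bigsupP : forall X : set T, isLub X (bigsup X)
}.

#[short(type="completeLatticeType")]
HB.structure Definition CompleteLattice d :=
  { T of Order.TBLattice d T & isCompleteLattice d T }.

(* The bottom [\bot] and top [\top] are the 0 and 1 of the lattice. In
   [lmul_bigsupr] the set X may be empty, so that x * 0 = 0. *)
HB.mixin Record isMultiplicativeLattice d T of CompleteLattice d T := {
  lmul : T -> T -> T;
  lmulA : associative lmul;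
  lmulC : commutative lmul;
  lmul1x : left_id (\top : T) lmul;
  lmul_bigsupr : forall (x : T) (X : set T),
    lmul x (bigsup X) = bigsup [set lmul x y | y in X]
}.

#[short(type="multLatticeType")]
HB.structure Definition MultiplicativeLattice d :=
  { T of CompleteLattice d T & isMultiplicativeLattice d T }.

Section Elements.
Context {d : Order.disp_t} {L : multLatticeType d}.
Implicit Types (a b c m s x : L) (X : set L).

(* Families are taken nonempty, since the finite subfamilies extracted from
   them are: this makes \bot compact. *)
Definition compact_element c :=
  forall X, X !=set0 -> c <= bigsup X ->
  exists (n : nat) (x : 'I_n.+1 -> L),
    (forall i, X (x i)) /\ c <= \join_(i < n.+1) x i.

Definition maximal_element m :=
  m != \top /\ (forall x, m <= x -> x < \top -> m = x).

Definition maximals_above a : set L :=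
  [set m | maximal_element m /\ a <= m].

Definition z_element x :=
  forall a b, maximals_above a = maximals_above b -> b <= x -> a <= x.

Definition strongly_irreducible s :=
  forall a b, a `&` b <= s -> a <= s \/ b <= s.

Definition irreducible s :=
  forall a b, a `&` b = s -> a = s \/ b = s.

Definition z_strongly_irreducible s :=
  z_element s /\
  (forall a b, z_element a -> z_element b ->
    a `&` b <= s -> a <= s \/ b <= s).

Definition z_irreducible s :=
  z_element s /\
  (forall a b, z_element a -> z_element b ->
    a `&` b = s -> a = s \/ b = s).

End Elements.

Definition compactly_generated {d} (L : multLatticeType d) :=
  forall x : L, exists2 X : set L, X `<=` compact_element & x = bigsup X.

Definition compact_products {d} (L : multLatticeType d) :=
  forall (n : nat) (c : 'I_n -> L),
    (forall i, compact_element (c i)) ->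
    compact_element (\big[lmul / \top]_(i < n) c i).

(* Main.v *)
Require Import Defs.
From mathcomp Require Import all_boot all_order.
From mathcomp Require Import classical_sets.

Import Order.TTheory.
Local Open Scope classical_set_scope.
Local Open Scope order_scope.

(** Maximal elements are prime, so the maximal elements above [x y] are those
    above [x] or above [y]. Hence for a z-element [s] every residual
    [s : a] is again a z-element, and [c c <= s] forces [c <= s]. If
    [a `&` b <= s] then [a b <= s]; applying the first fact twice, [a] and [b]
    may be replaced by their z-closures [a_z] and [b_z], and the second
    fact applied to [c = a_z `&` b_z] gives [a_z `&` b_z <= s]. *)

Section ZElements.
Context {d : Order.disp_t} {L : multLatticeType d}.
Implicit Types (a b c m s u v x y z : L) (X : set L).

Lemma bigsup_ub X x : X x -> x <= bigsup X.
Proof. by have [ubX _] := bigsupP X; exact: ubX. Qed.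

Lemma bigsup_le X y : (forall x, X x -> x <= y) -> bigsup X <= y.
Proof. by have [_ lbX] := bigsupP X; exact: lbX. Qed.

Lemma bigsup2 x y : bigsup [set x; y] = x `|` y.
Proof.
apply/le_anti/andP; split.
  by apply: bigsup_le => _ [] ->; rewrite ?leUl ?leUr.
by rewrite leUx; apply/andP; split; apply: bigsup_ub; [left|right].
Qed.

Lemma lmulUr x y z : lmul x (y `|` z) = lmul x y `|` lmul x z.
Proof. by rewrite -!bigsup2 lmul_bigsupr image_setU !image_set1. Qed.

Lemma lmul_le2l x y z : y <= z -> lmul x y <= lmul x z.
Proof. by move=> /join_r <-; rewrite lmulUr leUl. Qed.

Lemma lmul_lel x y : lmul x y <= x.
Proof. by rewrite -[leRHS]lmul1x (lmulC \top); apply/lmul_le2l/lex1. Qed.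

Lemma lmul_ler x y : lmul x y <= y.
Proof. by rewrite lmulC; exact: lmul_lel. Qed.

(** If [x] is not below [m], maximality makes the join of [x] and [m] equal to [\top], so [y] is the
    join of [lmul y x] and [lmul y m], both below [m]. *)
Lemma maximal_prime m x y : maximal_element m ->
  lmul x y <= m <-> x <= m \/ y <= m.
Proof.
move=> [_ mmax]; split; last first.
  by case; apply: le_trans; [exact: lmul_lel|exact: lmul_ler].
move=> xym; case: (boolP (x <= m)) => [|xNm]; first by left.
have xm1 : x `|` m = \top.
  apply/eqP/negPn/negP => xm_neq1; move/negP: xNm; apply.
  by rewrite (mmax (x `|` m)) ?leUl ?leUr// lt_neqAle xm_neq1 lex1.
right; rewrite -[y]lmul1x -xm1 lmulC lmulUr leUx lmulC xym /=.
exact: lmul_ler.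
Qed.

Lemma maximals_above_lmul x y :
  maximals_above (lmul x y) = (maximals_above x `|` maximals_above y)%classic.
Proof.
apply/seteqP; split=> [m [mmax /(maximal_prime _ _ _ mmax)[]]|m [[mmax xm]|[mmax xm]]].
- by left.
- by right.
- by split=> //; apply/(maximal_prime _ _ _ mmax); left.
- by split=> //; apply/(maximal_prime _ _ _ mmax); right.
Qed.

(** [c] and [lmul c c] lie below the same maximal elements. *)
Lemma z_element_sqr s c : z_element s -> lmul c c <= s -> c <= s.
Proof. by move=> zs; apply: zs; rewrite maximals_above_lmul setUid. Qed.

Lemma z_elementI a b : z_element a -> z_element b -> z_element (a `&` b).
Proof.
move=> za zb u v uv; rewrite !lexI => /andP[va vb].
by rewrite (za _ _ uv va) (zb _ _ uv vb).
Qed.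

Definition residual s a : L := bigsup [set x | lmul a x <= s].

(** Distributivity over arbitrary joins keeps [lmul a (residual s a)] below [s], so the join is
    itself a member of the defining set. *)
Lemma residualP s a x : lmul a x <= s <-> x <= residual s a.
Proof.
split=> [axs|/(lmul_le2l a)/le_trans]; first exact: bigsup_ub.
by apply; rewrite lmul_bigsupr; apply: bigsup_le => _ [y ays <-].
Qed.

(** For fixed [a], the maximal elements above [lmul a u] are determined by those above [u]. *)
Lemma z_element_residual s a : z_element s -> z_element (residual s a).
Proof.
move=> zs u v uv /residualP avs; apply/residualP.
by apply: zs avs; rewrite !maximals_above_lmul uv.
Qed.

(** The meet of all z-elements above [a], as the join of the lower bounds. *)
Definition zclosure a : L :=
  bigsup [set x | forall z, z_element z -> a <= z -> x <= z].

Lemma le_zclosure a : a <= zclosure a.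
Proof. exact: bigsup_ub. Qed.

Lemma zclosure_min a z : z_element z -> a <= z -> zclosure a <= z.
Proof. by move=> zz az; apply: bigsup_le => x; exact. Qed.

Lemma z_element_zclosure a : z_element (zclosure a).
Proof.
move=> u v uv va; apply: bigsup_ub => z zz az; apply: (zz _ _ uv).
exact: le_trans va (zclosure_min _ _ zz az).
Qed.

Lemma zclosureI_le s a b : z_element s ->
  a `&` b <= s -> zclosure a `&` zclosure b <= s.
Proof.
move=> zs abs; have abs' : lmul a b <= s.
  by apply: le_trans abs; rewrite lexI lmul_lel lmul_ler.
(* [b] lies below the z-element [residual s a], hence so does its closure. *)
have azbs : lmul a (zclosure b) <= s.
  by apply/residualP/zclosure_min; [exact: z_element_residual|exact/residualP].
have zazbs : lmul (zclosure b) (zclosure a) <= s.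
  apply/residualP/zclosure_min; first exact: z_element_residual.
  by apply/residualP; rewrite lmulC.
(* The square of the meet is below the product of the closures, one factor being enlarged at a
   time. *)
apply: z_element_sqr => //; apply: le_trans zazbs.
apply: (@le_trans _ _ (lmul (zclosure a `&` zclosure b) (zclosure a))).
  exact/lmul_le2l/leIl.
by rewrite ![lmul _ (zclosure a)]lmulC; exact/lmul_le2l/leIr.
Qed.

End ZElements.

Theorem proposition5p2 (d : Order.disp_t) (L : multLatticeType d)
  (hgen : compactly_generated L)
  (htop : compact_element (Order.top : L))
  (hprod : compact_products L)
  (s : L) :
  (z_strongly_irreducible s <-> strongly_irreducible s /\ z_element s) /\
  (z_irreducible s <-> irreducible s /\ z_element s).
Proof.
split; split=> [[zs irr]|[irr zs]]; split=> // a b.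
- move=> /(zclosureI_le _ _ _ zs).
  by case/(irr _ _ (z_element_zclosure a) (z_element_zclosure b)) => h;
    [left|right]; exact: le_trans (le_zclosure _) h.
- by move=> _ _; exact: irr.
- move=> abs; have sa : s <= a by rewrite -abs leIl.
  have sb : s <= b by rewrite -abs leIr.
  (* The meet of the closures cannot drop below [s], which is under [a] and [b]. *)
  have zab : zclosure a `&` zclosure b = s.
    apply/le_anti; rewrite zclosureI_le ?abs//= lexI.
    by rewrite !(le_trans _ (le_zclosure _)).
  (* If a closure equals [s], the original element is squeezed between [s] and that closure. *)
  case: (irr _ _ (z_element_zclosure a) (z_element_zclosure b) zab) => zE.
  + by left; apply/le_anti; rewrite sa -zE le_zclosure.
  + by right; apply/le_anti; rewrite sb -zE le_zclosure.
- by move=> _ _; exact: irr.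
Qed.
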